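(* Let $H$ be a monoid and let $r$ be a finitary ideal system on $H$. The following are equivalent: (1) Every principal ideal of $H$ is an $r$-product of finitely many pairwise comparable radical $r$-ideals of $H$. (2) The radical of every nontrivial principal ideal of $H$ is $r$-invertible. (3) The radical of every $r$-invertible $r$-ideal of $H$ is $r$-invertible. (4) The radical of every principal ideal of the monoid $\mathcal{I}_r^*(H)$ is principal. (5) Every $r$-invertible $r$-ideal of $H$ is an $r$-product of finitely many pairwise comparable radical $r$-ideals of $H$.
   Context: A monoid $H$ is a commutative semigroup with identity and more than one element in which every nonzero element is cancellative. Here $z(H)=\{z\in H: zx=z \text{ for all } x\in H\}$ ($|z(H)|\le 1$, possibly empty); ''nonzero'' means not in $z(H)$; $H^{\bullet}=H\setminus z(H)$; $G=(H^{\bullet})^{-1}H$ is the quotient monoid; $\mathbb{N}$ is the set of positive integers. For $X\subseteq H$, $\sqrt X=\{x\in H: x^n\in X\text{ for some }n\in\mathbb{N}\}$, and $X$ is radical if $\sqrt X=X$; for $Y\subseteq G$, $Y^{-1}=\{z\in G: zY\subseteq H\}$. A principal ideal is a set $AH\cup z(H)$ with $A\subseteq H$, $|A|\le 1$; it is nontrivial if it properly contains $z(H)$. A finitary ideal system on $H$ is a map $r:\mathbb{P}(H)\to\mathbb{P}(H)$, $X\mapsto X_r$ ($\mathbb{P}$ = power set) such that for all $X,Y\subseteq H$, $c\in H$: $XH\cup z(H)\subseteq X_r$; $X\subseteq Y_r$ implies $X_r\subseteq Y_r$; $cX_r=(cX)_r$; $X_r=\bigcup_{E\subseteq X,|E|<\infty}E_r$.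 An $r$-ideal is an $X\subseteq H$ with $X_r=X$; it is $r$-invertible if $(XX^{-1})_r=H$. The $r$-product of $r$-ideals $I,J$ is $(IJ)_r$ (similarly for finitely many factors). $\mathcal{I}_r^*(H)$ is the set of $r$-invertible $r$-ideals, which is a monoid under $r$-multiplication; principal ideals and radicals in this monoid are defined as for $H$. ''Comparable'' means comparable with respect to inclusion.
   Formalization: The formal theorem also assumes that the r-closure of the empty set is z(H); this excludes only the case where H is a group without zero and X_r = H for all X, where the empty principal ideal makes (1) fail while (2) holds. *)

(* Defs.v *)
From HB Require Import structures.
From mathcomp Require Import all_boot.
From mathcomp Require Import all_classical.

Set Implicit Arguments.
Unset Strict Implicit.
Unset Printing Implicit Defensive.

Local Open Scope classical_set_scope.
Local Open Scope quotient_scope.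
Local Open Scope group_scope.

HB.mixin Record Monoid_isCommutative H of Monoid H := {
  mulgC : commutative (fun x y : H => x * y)
}.

#[short(type="comMonoidType")]
HB.structure Definition ComMonoid := {H of Monoid_isCommutative H & Monoid H}.

(* z(H): it has at most one element, and is empty if H has no zero. *)
Definition zeros (H : comMonoidType) : set H := [set z | forall x, z * x = z].
Arguments zeros H : clear implicits.

HB.mixin Record ComMonoid_isCancellative H of ComMonoid H := {
  nontrivial_monoid : exists x y : H, x <> y;
  mulgI_nz : forall a : H, ~ zeros H a -> injective (fun x : H => a * x)
}.

#[short(type="cancMonoidType")]
HB.structure Definition CancMonoid :=
  {H of ComMonoid_isCancellative H & ComMonoid H}.

Definition mulset (H : comMonoidType) (X Y : set H) : set H :=
  [set x * y | x in X & y in Y].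

Definition radical (H : comMonoidType) (X : set H) : set H :=
  [set x | exists2 n : nat, (0 < n)%N & X (x ^+ n)].

Definition is_radical (H : comMonoidType) (X : set H) : Prop := radical X = X.

Definition principal_ideal (H : comMonoidType) (P : set H) : Prop :=
  exists2 A : set H, is_subset1 A & P = mulset A setT `|` zeros H.

Definition nontrivial_principal_ideal (H : comMonoidType) (P : set H) : Prop :=
  principal_ideal P /\ zeros H `<` P.

Section ComMonoidTheory.
Variable H : comMonoidType.
Implicit Types (x y z : H) (X Y Z : set H).

Lemma mulgAC x y z : x * y * z = x * z * y.
Proof. by rewrite -!mulgA (mulgC y). Qed.

Lemma mulgCA x y z : x * (y * z) = y * (x * z).
Proof. by rewrite !mulgA (mulgC x). Qed.

Lemma mulgACA x y z t : (x * y) * (z * t) = (x * z) * (y * t).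
Proof. by rewrite -!mulgA (mulgCA y). Qed.

Lemma mulsetC X Y : mulset X Y = mulset Y X.
Proof.
by apply/seteqP; split => _ [x ? [y ? <-]]; exists y => //; exists x => //;
  rewrite mulgC.
Qed.

Lemma mulsetA X Y Z : mulset X (mulset Y Z) = mulset (mulset X Y) Z.
Proof.
apply/seteqP; split.
  move=> _ [x Xx [_ [y Yy [z Zz <-]] <-]]; exists (x * y); last first.
    by exists z => //; rewrite mulgA.
  by exists x => //; exists y.
move=> _ [_ [x Xx [y Yy <-]] [z Zz <-]]; exists x => //; exists (y * z).
  by exists y => //; exists z.
by rewrite mulgA.
Qed.

End ComMonoidTheory.

Section QuotientMonoid.
Variable H : cancMonoidType.

Lemma nzP (a : H) : reflect (~ zeros H a) (a \notin zeros H).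
Proof. by apply: (iffP idP); rewrite notin_setE. Qed.

Lemma mulg_nz (a b : H) : a \notin zeros H -> b \notin zeros H ->
  a * b \notin zeros H.
Proof.
move=> /nzP na /nzP nb; apply/nzP => zab; apply: nb => x.
by apply: (mulgI_nz a na) => /=; rewrite mulgA zab.
Qed.

Lemma one_nz : (1 : H) \notin zeros H.
Proof.
apply/nzP => z1; have [x [y]] := @nontrivial_monoid H.
by apply; rewrite -(mul1g x) -(mul1g y) !z1.
Qed.

Record fracrep : Type :=
  FracRep { numden :> H * H; numden_nz : numden.2 \notin zeros H }.
HB.instance Definition _ := [isSub for numden].
HB.instance Definition _ := [Choice of fracrep by <:].

Implicit Types p q : fracrep.

Definition frac_equiv p q : bool := p.1 * q.2 == q.1 * p.2.

Lemma frac_equiv_refl : reflexive frac_equiv.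
Proof. by move=> p; rewrite /frac_equiv. Qed.

Lemma frac_equiv_sym : symmetric frac_equiv.
Proof. by move=> p q; rewrite /frac_equiv eq_sym. Qed.

Lemma frac_equiv_trans : transitive frac_equiv.
Proof.
move=> q p r /eqP pq /eqP qr; apply/eqP.
have /nzP nq := numden_nz q.
apply: (mulgI_nz _ nq) => /=.
by rewrite !mulgA (mulgC q.2 p.1) pq (mulgC q.2 r.1) -qr mulgAC.
Qed.

Canonical frac_equivRel :=
  EquivRel frac_equiv frac_equiv_refl frac_equiv_sym frac_equiv_trans.

(* The quotient monoid G of H, made of the fractions a/b with b nonzero; to_quotm
   below embeds H into it. *)
Definition quotm : Type := {eq_quot frac_equiv}.
HB.instance Definition _ : EqQuotient _ frac_equiv quotm := EqQuotient.on quotm.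
HB.instance Definition _ := Choice.on quotm.

Definition mkfrac (a b : H) (nb : b \notin zeros H) : quotm :=
  \pi_quotm (@FracRep (a, b) nb).

Lemma mkfrac_eq a b nb c d nd :
  (@mkfrac a b nb = @mkfrac c d nd) <-> a * d = c * b.
Proof. by split=> [/eqmodP/eqP //|e]; apply/eqmodP/eqP. Qed.

Lemma quotmP (u : quotm) : exists a b nb, u = @mkfrac a b nb.
Proof.
by elim/quotW: u => -[[a b] /= nb]; exists a, b, nb; congr (\pi _); apply/val_inj.
Qed.

Definition mul_frac p q : fracrep :=
  @FracRep (p.1 * q.1, p.2 * q.2) (mulg_nz (numden_nz p) (numden_nz q)).

Definition mul_quotm (u v : quotm) : quotm := \pi_quotm (mul_frac (repr u) (repr v)).

Lemma mul_mkfrac a b nb c d nd :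
  mul_quotm (@mkfrac a b nb) (@mkfrac c d nd)
  = @mkfrac (a * c) (b * d) (mulg_nz nb nd).
Proof.
rewrite /mul_quotm /mkfrac; apply/eqmodP/eqP => /=.
set p := @FracRep (a, b) nb; set q := @FracRep (c, d) nd.
have /eqP ep : frac_equiv (repr (\pi_quotm p)) p by apply/eqmodP; rewrite reprK.
have /eqP eq : frac_equiv (repr (\pi_quotm q)) q by apply/eqmodP; rewrite reprK.
by rewrite mulgACA [RHS]mulgACA; congr (_ * _).
Qed.

Definition to_quotm (a : H) : quotm := mkfrac a one_nz.

Lemma mul_quotmA : associative mul_quotm.
Proof.
move=> u v w; have [a [b [nb ->]]] := quotmP u.
have [c [d [nd ->]]] := quotmP v; have [e [f [nf ->]]] := quotmP w.
by rewrite !mul_mkfrac; apply/mkfrac_eq; rewrite !mulgA.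
Qed.

Lemma mul_quotmC : commutative mul_quotm.
Proof.
move=> u v; have [a [b [nb ->]]] := quotmP u; have [c [d [nd ->]]] := quotmP v.
by rewrite !mul_mkfrac; apply/mkfrac_eq; rewrite (mulgC a) (mulgC b).
Qed.

Lemma mul1_quotm : left_id (to_quotm 1) mul_quotm.
Proof.
move=> u; have [a [b [nb ->]]] := quotmP u.
by rewrite /to_quotm mul_mkfrac; apply/mkfrac_eq; rewrite !mul1g.
Qed.

Lemma mulg1_quotm : right_id (to_quotm 1) mul_quotm.
Proof. by move=> u; rewrite mul_quotmC mul1_quotm. Qed.

HB.instance Definition _ :=
  isMonoid.Build quotm mul_quotmA mul1_quotm mulg1_quotm.
HB.instance Definition _ := Monoid_isCommutative.Build quotm mul_quotmC.

Lemma to_quotm1 : to_quotm 1 = 1. Proof. by []. Qed.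

Lemma to_quotmM a b : to_quotm (a * b) = to_quotm a * to_quotm b.
Proof.
by rewrite /to_quotm [RHS]mul_mkfrac; apply/mkfrac_eq; rewrite !mulg1.
Qed.

Lemma to_quotm_inj : injective to_quotm.
Proof. by move=> a b /mkfrac_eq; rewrite !mulg1. Qed.

Lemma to_quotm_inv a : ~ zeros H a -> exists u : quotm, to_quotm a * u = 1.
Proof.
move=> /nzP na; exists (mkfrac 1 na).
by rewrite -to_quotm1 /to_quotm [LHS]mul_mkfrac; apply/mkfrac_eq; rewrite !mulg1 !mul1g.
Qed.

Lemma quotm_frac (u : quotm) :
  exists a b, ~ zeros H b /\ u * to_quotm b = to_quotm a.
Proof.
have [a [b [nb ->]]] := quotmP u; exists a, b; split; first exact/nzP.
by rewrite /to_quotm [LHS]mul_mkfrac; apply/mkfrac_eq; rewrite !mulg1.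
Qed.

(* Y^{-1} = {z in G | zY is contained in H} *)
Definition invset (Y : set quotm) : set quotm :=
  [set z | [set z * y | y in Y] `<=` range to_quotm].

(* X X^{-1}, which is contained in H, as a subset of H. *)
Definition mul_invset (X : set H) : set H :=
  to_quotm @^-1` mulset (to_quotm @` X) (invset (to_quotm @` X)).

End QuotientMonoid.

Record finIdealSystem (H : cancMonoidType) := FinIdealSystem {
  rclos :> set H -> set H;
  rclos_ext : forall X, mulset X setT `|` zeros H `<=` rclos X;
  rclos_sub : forall X Y, X `<=` rclos Y -> rclos X `<=` rclos Y;
  rclos_mul : forall (c : H) X,
    [set c * x | x in rclos X] = rclos [set c * x | x in X];
  rclos_fin : forall X,
    rclos X = \bigcup_(E in [set E | E `<=` X /\ finite_set E]) rclos E
}.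

Section IdealSystem.
Variables (H : cancMonoidType) (r : finIdealSystem H).
Implicit Types X Y I J : set H.

Definition r_ideal X : Prop := r X = X.

Definition r_invertible X : Prop := r (mul_invset X) = setT.

(* The setwise product is closed only once; for n = 0 this is {1}_r = H, the
   identity of r-multiplication. *)
Definition r_prod n (I : 'I_n -> set H) : set H :=
  r (\big[@mulset H/[set 1]]_(i < n) I i).

Definition rprod_comparable_radical X : Prop :=
  exists (n : nat) (I : 'I_n -> set H),
    [/\ forall i, r_ideal (I i) /\ is_radical (I i),
        forall i j, I i `<=` I j \/ I j `<=` I i &
        X = r_prod I].

Definition r_invertible_ideals : set (set H) :=
  [set X | r_ideal X /\ r_invertible X].

Lemma rclos_id X : X `<=` r X.
Proof.
move=> x Xx; apply: rclos_ext; left.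
by exists x => //; exists 1; rewrite ?mulg1.
Qed.

Lemma rclosS X Y : X `<=` Y -> r X `<=` r Y.
Proof. by move=> XY; apply: rclos_sub => x /XY; apply: rclos_id. Qed.

Lemma rclosK X : r (r X) = r X.
Proof. by apply/seteqP; split; [exact: rclos_sub | exact: rclos_id]. Qed.

Lemma rclosT : r setT = setT.
Proof. by apply/seteqP; split => // x _; exact: rclos_id. Qed.

Lemma rclos_mulsetl X Y : r (mulset (r X) Y) = r (mulset X Y).
Proof.
apply/seteqP; split; last first.
  apply: rclosS => _ [x Xx [y Yy <-]]; exists x; first exact: rclos_id.
  by exists y.
apply: rclos_sub => _ [x Xx [y Yy <-]]; rewrite mulgC.
have : r [set y * x | x in X] (y * x) by rewrite -rclos_mul; exists x.
apply: rclosS => _ [x' Xx' <-]; exists x' => //; exists y => //.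
by rewrite mulgC.
Qed.

Lemma rclos_mulsetr X Y : r (mulset X (r Y)) = r (mulset X Y).
Proof. by rewrite mulsetC rclos_mulsetl mulsetC. Qed.

(* The second case occurs only if H is a group. There the empty set is a
   principal ideal but not an r-ideal, hence not an r-product of r-ideals. *)
Lemma rclos_set0 :
  r set0 = zeros H \/ zeros H = set0 /\ forall X, r X = setT.
Proof.
have [[z zz]|/forallNP nz] := pselect (exists z, zeros H z).
  left; apply/seteqP; split; last by move=> x zx; apply: rclos_ext; right.
  have := rclos_mul r z set0; rewrite image_set0 => <- _ [x _ <-] y.
  by rewrite !zz.
have z0 : zeros H = set0 by apply/seteqP; split => // x /nz.
have [[x rx]|/forallNP nr] := pselect (exists x, r set0 x); last first.
  by left; rewrite z0; apply/seteqP; split => // x /nr.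
right; split=> // X; apply/seteqP; split => // y _.
have : [set x * u | u in r set0] x by rewrite rclos_mul image_set0.
case=> u ru; rewrite -[X in _ = X]mulg1 => /(mulgI_nz _ (nz x)) u1.
move: ru; rewrite u1 => r1; apply: (@rclosS set0) => //.
rewrite -rclosK; apply: rclos_ext; left; exists 1 => //; exists y => //.
exact: mul1g.
Qed.

(* I_r^*(H), with the r-multiplication (I, J) |-> (IJ)_r as its operation. *)
Definition rinv_monoid : Type := set_type r_invertible_ideals.

HB.instance Definition _ := Choice.on rinv_monoid.

Lemma r_invertible_ideals1 : r_invertible_ideals setT.
Proof.
split; first exact: rclosT.
rewrite /r_invertible; suff -> : mul_invset (@setT H) = setT by exact: rclosT.
apply/seteqP; split => // x _; exists (to_quotm x); first by exists x.
exists 1; last by rewrite mulg1.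
by move=> _ [_ [y _ <-] <-]; exists y => //; rewrite mul1g.
Qed.

Lemma r_invertible_idealsM I J : r_invertible_ideals I ->
  r_invertible_ideals J -> r_invertible_ideals (r (mulset I J)).
Proof.
move=> [rI iI] [rJ iJ]; split; first exact: rclosK.
apply/seteqP; split => // x _.
have : r (mulset (mul_invset I) (mul_invset J)) x.
  rewrite -rclos_mulsetl -rclos_mulsetr iI iJ; apply: rclos_id.
  by exists x => //; exists 1; rewrite ?mulg1.
apply: rclosS => _ [a + [b + <-]].
move=> [_ [i Ii <-] [u iu iua]] [_ [j Jj <-] [v jv jvb]].
exists (to_quotm (i * j)).
  by exists (i * j) => //; apply: rclos_id; exists i => //; exists j.
exists (u * v); last by rewrite !to_quotmM mulgACA iua jvb.
move=> _ [_ [y ry <-] <-].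
have [a' [b' [nb' eb']]] := quotm_frac (u * v).
have : r [set b' * t | t in @setT H] (a' * y).
  have : [set a' * t | t in r (mulset I J)] (a' * y) by exists y.
  rewrite rclos_mul; apply: rclosS => _ [_ [i' Ii' [j' Jj' <-]] <-].
  have [s _ es] : range (@to_quotm H) (u * to_quotm i').
    by apply: iu; exists (to_quotm i') => //; exists i'.
  have [t _ et] : range (@to_quotm H) (v * to_quotm j').
    by apply: jv; exists (to_quotm j') => //; exists j'.
  exists (s * t) => //; apply: to_quotm_inj.
  rewrite !to_quotmM es et -eb' mulgACA mulgA.
  by rewrite (mulgC _ (to_quotm b')).
rewrite -rclos_mul rclosT => -[t _ et]; exists t => //.
have [w ew] := to_quotm_inv nb'.
have := congr1 (fun s => w * to_quotm s) et.
rewrite /= !to_quotmM -eb' !mulgA (mulgC w) ew mul1g => ->.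
by rewrite -!mulgA (mulgCA v) (mulgCA u) (mulgA w) (mulgC w) ew mul1g.
Qed.

Definition rinv_one : rinv_monoid := SigSub (mem_set r_invertible_ideals1).

Definition rinv_mul (I J : rinv_monoid) : rinv_monoid :=
  SigSub (mem_set (r_invertible_idealsM (set_mem (valP I)) (set_mem (valP J)))).

Lemma rinv_mulA : associative rinv_mul.
Proof.
move=> I J K; apply/val_inj => /=.
by rewrite rclos_mulsetl rclos_mulsetr mulsetA.
Qed.

Lemma rinv_mulC : commutative rinv_mul.
Proof. by move=> I J; apply/val_inj => /=; rewrite mulsetC. Qed.

Lemma rinv_mul1 : left_id rinv_one rinv_mul.
Proof.
move=> I; apply/val_inj => /=; have [rI _] := set_mem (valP I).
rewrite -[RHS]rI; apply/seteqP; split; last first.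
  by apply: rclosS => x Ix; exists 1 => //; exists x; rewrite ?mul1g.
apply: rclos_sub => _ [x _ [y Iy <-]]; apply: rclos_ext; left.
by exists y => //; exists x => //; rewrite mulgC.
Qed.

Lemma rinv_mulr1 : right_id rinv_one rinv_mul.
Proof. by move=> I; rewrite rinv_mulC rinv_mul1. Qed.

HB.instance Definition _ :=
  isMonoid.Build rinv_monoid rinv_mulA rinv_mul1 rinv_mulr1.
HB.instance Definition _ := Monoid_isCommutative.Build rinv_monoid rinv_mulC.

End IdealSystem.

(* Main.v *)
From HB Require Import structures.
Require Import Defs.
From mathcomp Require Import all_boot.
From mathcomp Require Import all_classical.

Set Implicit Arguments.
Unset Strict Implicit.
Unset Printing Implicit Defensive.

Local Open Scope classical_set_scope.
Local Open Scope group_scope.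

(** The cycle (1) => (2) => (3) => (4) => (5) => (1) is proved.

    The basic facts on r-invertible ideals are the expected ones: they are
    r-finitely generated, may be cancelled, containment among them is
    divisibility, and a factor of an r-invertible r-ideal is r-invertible
    ([r_invertible_fg], [r_invertible_cancel], [r_invertible_dvd],
    [r_invertible_factor]).  The common argument is that, when I is
    r-invertible, membership in an r-closed set may be tested after
    multiplication by all elements of II^{-1} ([r_invertible_detect]); the facts
    on factors and on cancellation also need that multiplication by a
    fraction is compatible with r-closure ([rclos_frac]).

    (1) => (2): if aH is the r-product of a chain of radical r-ideals, then its
    radical is the smallest member of the chain, a factor of aH.

    (2) => (3): let I be r-invertible.  An element s = ey of II^{-1}, with e in
    I and y in I^{-1}, maps I into eH, hence maps the radical of I into the
    radical R of eH.  So s R^{-1} lies in the inverse of the radical of I, and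
    since R is contained in that radical, s itself lies in the r-closure of the
    radical times its inverse; this is trivial if e, and with it s, is zero.
    The r-closure of the set of all elements s is H.

    (3) => (4): as r-invertible ideals are r-finitely generated, J is contained
    in the radical of I exactly when some power of J is contained in I, i.e. is
    divisible by I ([rinv_radicalP]).  So the radical of the principal ideal
    generated by I is generated by the radical of I.

    (4) => (5) takes place in an arbitrary cancellative commutative monoid in
    which the radical of every principal ideal is principal
    ([radical_factorization]).  Write rad a for a generator of the radical of
    aM, and a = b a1 with b = rad a.  If a divides b^(n+2) then a1 divides
    b^(n+1), and the point is that a1 already divides (rad a1)^(n+1): the
    exponent drops and the induction ends.  This holds because rad a1 is a
    factor of the radical element b, b = (rad a1) k, and complementary factors
    of a radical element are coprime in the strong sense that any power of the
    one may be removed from a divisibility by a power of the other.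

    (5) => (1): a nontrivial principal ideal is r-invertible, and the trivial
    one is itself a radical r-ideal. *)

(** * Radical factorization in cancellative monoids *)

Section RadicalFactorization.
Variable M : comMonoidType.
Implicit Types (a b c d x y : M) (s : seq M).

Definition mdvd a b : Prop := exists c, b = a * c.

Definition radical_elt b : Prop :=
  forall x n, (0 < n)%N -> mdvd b (x ^+ n) -> mdvd b x.

Lemma mdvd_refl a : mdvd a a.
Proof. by exists 1; rewrite mulg1. Qed.

Lemma mdvd_trans b a c : mdvd a b -> mdvd b c -> mdvd a c.
Proof. by move=> [u ->] [v ->]; exists (u * v); rewrite mulgA. Qed.

Lemma mdvd_mulr a b c : mdvd a b -> mdvd a (b * c).
Proof. by move=> [u ->]; exists (u * c); rewrite mulgA. Qed.

Lemma mdvd_mull a b c : mdvd a b -> mdvd a (c * b).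
Proof. by rewrite mulgC; exact: mdvd_mulr. Qed.

Lemma mdvd_mul a b c d : mdvd a b -> mdvd c d -> mdvd (a * c) (b * d).
Proof. by move=> [u ->] [v ->]; exists (u * v); rewrite mulgACA. Qed.

Lemma mdvd_prod s c : c \in s -> mdvd c (\big[*%g/1]_(d <- s) d).
Proof.
elim: s => // d s IHs; rewrite inE big_cons => /predU1P[->|/IHs].
  exact/mdvd_mulr/mdvd_refl.
exact: mdvd_mull.
Qed.

Hypothesis cancel : forall a b c, a * b = a * c -> b = c.

Lemma mdvd_cancel a b c : mdvd (a * b) (a * c) -> mdvd b c.
Proof. by move=> [u]; rewrite -mulgA => /cancel ->; exists u. Qed.

(** A product cd that is a radical element is the least common multiple of c
    and d: if both divide w, then cd divides w^2, hence w.  This is applied to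
    w = dx. *)
Lemma radical_elt_coprime c d x :
  radical_elt (c * d) -> mdvd c (d * x) -> mdvd c x.
Proof.
move=> cdrad cdx; apply: (@mdvd_cancel d); rewrite mulgC.
apply: (cdrad _ 2) => //; rewrite expg2; apply: mdvd_mul => //.
exact/mdvd_mulr/mdvd_refl.
Qed.

(** The powers of d are removed one at a time for a single factor c; then one
    factor c of x after the other is split off. *)
Lemma radical_elt_coprimeX c d i j x :
  radical_elt (c * d) -> mdvd (c ^+ i) (d ^+ j * x) -> mdvd (c ^+ i) x.
Proof.
move=> cdrad; have coprimeX w : mdvd c (d ^+ j * w) -> mdvd c w.
  elim: j w => [w|j IHj w]; first by rewrite expg0 mul1g.
  by rewrite expgS -mulgA => /(radical_elt_coprime cdrad)/IHj.
elim: i x => [x _|i IHi x]; first by exists x; rewrite expg0 mul1g.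
rewrite expgS => cix.
have [w xE] : mdvd c x.
  by apply: coprimeX; apply: mdvd_trans cix; apply/mdvd_mulr/mdvd_refl.
move: cix; rewrite {}xE mulgCA => /mdvd_cancel/IHi.
by apply: mdvd_mul; exact: mdvd_refl.
Qed.

(** The radical of every principal ideal is principal. *)
Hypothesis rad_ex : forall a, exists b,
  forall x, (exists2 n, (0 < n)%N & mdvd a (x ^+ n)) <-> mdvd b x.

(** By induction on an exponent n such that a divides (rad a)^(n+1).  For n = 0
    the element a is associated to rad a, hence radical.  Every radical element
    that divides a power of rad a divides rad a, so putting rad a in front of
    the factorization of the cofactor keeps the factors pairwise comparable. *)
Lemma radical_factorization a : exists s,
  [/\ a = \big[*%g/1]_(c <- s) c, {in s, forall c, radical_elt c} &
      {in s &, forall c d, mdvd c d \/ mdvd d c}].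
Proof.
have [rad radP] := choice rad_ex.
have rad_elt b : radical_elt (rad b).
  move=> x n n0 /radP[m m0]; rewrite -expgnA => bx.
  by apply/radP; exists (n * m)%N; rewrite // muln_gt0 n0.
have rad_dvd b : mdvd (rad b) b.
  by apply/radP; exists 1%N; rewrite // expg1; exact: mdvd_refl.
have [n n0] : exists2 n, (0 < n)%N & mdvd a (rad a ^+ n).
  exact/radP/mdvd_refl.
case: n n0 => // n _; elim: n a => [|n IHn] a arad.
  exists [:: a]; split; first by rewrite big_seq1.
    move=> _ /[1!inE]/eqP-> x n n0 ax.
    by apply: (mdvd_trans arad); rewrite expg1; apply/radP; exists n.
  by move=> _ _ /[1!inE]/eqP-> /[1!inE]/eqP->; left; exact: mdvd_refl.
have [a1 aE] := rad_dvd a; set b := rad a in arad aE.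
have {}arad : mdvd a1 (b ^+ n.+1).
  by move: arad; rewrite {1}aE expgS => /mdvd_cancel.
set b1 := rad a1.
have [k bE] : mdvd b1 b by apply/radP; exists n.+1.
have [m _ [y yE]] : exists2 n, (0 < n)%N & mdvd a1 (b1 ^+ n).
  exact/radP/mdvd_refl.
have [s [a1E srad schain]] : exists s,
    [/\ a1 = \big[*%g/1]_(c <- s) c, {in s, forall c, radical_elt c} &
        {in s &, forall c d, mdvd c d \/ mdvd d c}].
  apply: IHn; rewrite -/b1.
  (* With a1 y = b1^m, the claim that a1 divides b1^(n+1) is multiplied by y so
     that its left side becomes a power of b1, coprime to k. *)
  suff : mdvd (b1 ^+ m) (y * b1 ^+ n.+1).
    by rewrite yE mulgC => /mdvd_cancel.
  apply: (@radical_elt_coprimeX b1 k _ n.+1).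
    by rewrite -bE; exact: rad_elt.
  move: arad => [x xE].
  exists x; rewrite mulgCA (mulgC (k ^+ _)) -expgMn; last exact: mulgC.
  by rewrite -bE xE yE mulgA (mulgC y).
have sb c : c \in s -> mdvd c b.
  move=> cs; apply: (srad c cs _ n.+1) => //; apply: mdvd_trans arad.
  by rewrite a1E; exact: mdvd_prod.
exists (b :: s); split; first by rewrite big_cons -a1E.
  by move=> c /[1!inE]/predU1P[->|/srad//]; exact: rad_elt.
move=> c d /[1!inE]/predU1P[->|cs] /[1!inE]/predU1P[->|ds].
- by left; exact: mdvd_refl.
- by right; exact: sb.
- by left; exact: sb.
- exact: schain.
Qed.

End RadicalFactorization.

(** * Powers and radicals of subsets *)

Section SetPowers.
Variable H : comMonoidType.
Implicit Types (x y : H) (X Y I : set H).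

Lemma mulset1g X : mulset [set 1] X = X.
Proof.
apply/seteqP; split; first by move=> _ [_ -> [x Xx <-]]; rewrite mul1g.
by move=> x Xx; exists 1 => //; exists x; rewrite ?mul1g.
Qed.

HB.instance Definition _ :=
  Monoid.isComLaw.Build (set H) [set 1] (@mulset H) (@mulsetA H) (@mulsetC H)
    mulset1g.

Definition setpow X n := iter n (mulset X) [set 1].

Definition semigroup_ideal I := forall x y, I x -> I (x * y).

Lemma radical_id X : X `<=` radical X.
Proof. by move=> x Xx; exists 1%N; rewrite ?expg1. Qed.

Lemma radicalS X Y : X `<=` Y -> radical X `<=` radical Y.
Proof. by move=> XY x [n n0 /XY]; exists n. Qed.

Lemma radical_semigroup_ideal I :
  semigroup_ideal I -> semigroup_ideal (radical I).
Proof.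
move=> II x y [n n0 Ix]; exists n => //.
by rewrite expgMn; [exact: II | exact: mulgC].
Qed.

Lemma setpow_exp X x n : X x -> setpow X n (x ^+ n).
Proof.
move=> Xx; elim: n => [|n IHn]; first by rewrite expg0.
by rewrite expgS; exists x => //; exists (x ^+ n).
Qed.

Lemma setpow_ge I X m n :
  semigroup_ideal I -> (m <= n)%N -> setpow X m `<=` I -> setpow X n `<=` I.
Proof.
move=> II /subnK<- XmI; elim: (n - m)%N => [|k IHk]; first exact: XmI.
by move=> _ [x Xx [y Xy <-]]; rewrite mulgC; apply: II; exact: IHk.
Qed.

(** If x^k and all products of m elements of s lie in I, then so does every
    product of k + m elements of x :: s: it contains x at least k times or at
    least m elements of s. *)
Lemma finite_sub_radical I X : semigroup_ideal I -> finite_set X ->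
  X `<=` radical I -> exists2 n, (0 < n)%N & setpow X n `<=` I.
Proof.
move=> II /finite_seqP[s ->]; elim: s => [|x s IHs] sI.
  by exists 1%N => // w [y ].
have [|m m0 smI] := IHs.
  by move=> y ys; apply: sI; rewrite /= inE ys orbT.
have [k k0 xkI] : radical I x by apply: sI; rewrite /= inE eqxx.
exists (k + m)%N; first by rewrite addn_gt0 k0.
have split_pow n w : setpow [set` x :: s] n w -> exists i j y,
    [/\ n = (i + j)%N, setpow [set` s] j y & w = x ^+ i * y].
  elim: n w => [|n IHn] w; first by exists 0%N, 0%N, 1; rewrite mul1g.
  move=> [z zs [v /IHn[i [j [y [-> sy ->]]]] <-]].
  move: zs; rewrite /= inE => /predU1P[->|zs].
    by exists i.+1, j, y; rewrite expgS mulgA.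
  exists i, j.+1, (z * y); split; rewrite ?addnS//; last exact: mulgCA.
  by exists z => //; exists y.
move=> w /split_pow[i [j [y [kmE sy ->]]]].
have [ki|ik] := leqP k i.
  by rewrite -(subnKC ki) expgnDr -mulgA; exact: II.
rewrite mulgC; apply: (II); apply: (setpow_ge II _ smI sy).
by rewrite -(leq_add2l k) kmE leq_add2r ltnW.
Qed.

End SetPowers.

(** * Invertibility with respect to a finitary ideal system *)

Section Quotient.
Variable H : cancMonoidType.
Implicit Types (a b x : H) (I X : set H) (u v y : quotm H).

Lemma to_quotm_cancel b u v :
  ~ zeros H b -> to_quotm b * u = to_quotm b * v -> u = v.
Proof.
move=> /to_quotm_inv[w bw] /(congr1 (mul w)).
by rewrite !mulgA (mulgC w) bw !mul1g.
Qed.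

Lemma invsetP I y : invset (@to_quotm H @` I) y <->
  forall i, I i -> exists h, to_quotm h = y * to_quotm i.
Proof.
split=> [Iy i Ii|Iy _ [_ [i Ii <-] <-]]; last first.
  by have [h <-] := Iy i Ii; exists h.
suff [h _ ?] : range (@to_quotm H) (y * to_quotm i) by exists h.
by apply: Iy; exists (to_quotm i) => //; exists i.
Qed.

Lemma mul_invsetP I x : mul_invset I x <-> exists i y,
  [/\ I i, invset (@to_quotm H @` I) y & to_quotm x = to_quotm i * y].
Proof.
split=> [[_ [i Ii <-] [y Iy xE]]|[i [y [Ii Iy xE]]]]; first by exists i, y.
by exists (to_quotm i); [exists i | exists y].
Qed.

End Quotient.

Section Ideals.
Variables (H : cancMonoidType) (r : finIdealSystem H).
Implicit Types (a b x h : H) (I J K X Y Z E : set H) (u v y : quotm H).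

(** For a fraction y = a/b this is the identity c X_r = (cX)_r applied to c = a
    and to c = b.  The quotient monoid carries no closure operator, so the
    inclusion of y X_r in Z_r is expressed through preimages in H. *)
Lemma rclos_frac y X Z :
  (forall x, X x -> exists2 h, Z h & to_quotm h = y * to_quotm x) ->
  forall x, r X x -> exists2 h, r Z h & to_quotm h = y * to_quotm x.
Proof.
move=> XZ x rx; have [a [b [nb yb]]] := quotm_frac y.
have : [set a * t | t in r X] (a * x) by exists x.
rewrite rclos_mul => rax.
have [h rh bh] : [set b * h | h in r Z] (a * x).
  rewrite rclos_mul; apply: rclosS rax => _ [t Xt <-].
  have [h Zh hE] := XZ t Xt; exists h => //; apply: to_quotm_inj.
  by rewrite !to_quotmM hE -yb mulgA (mulgC y).
exists h => //; apply: (to_quotm_cancel nb).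
by rewrite -to_quotmM bh to_quotmM -yb mulgA (mulgC y).
Qed.

Lemma rclos_mull x Y h : r Y h -> r [set x * t | t in Y] (x * h).
Proof. by move=> rh; rewrite -rclos_mul; exists h. Qed.

Lemma r_ideal_mulr I : r_ideal r I -> semigroup_ideal I.
Proof.
move=> rI x h Ix; rewrite -rI; apply: rclos_ext.
by left; exists x => //; exists h.
Qed.

Lemma zeros_r_ideal I : r_ideal r I -> zeros H `<=` I.
Proof. by move=> rI z zz; rewrite -rI; apply: rclos_ext; right. Qed.

Lemma rclos_sub_ideal X J : r_ideal r J -> X `<=` J -> r X `<=` J.
Proof. by move=> rJ XJ; rewrite -[X in _ `<=` X]rJ; exact: rclosS. Qed.

Lemma rclos_absorb X x h : r X x -> r X (x * h).
Proof. exact: r_ideal_mulr (rclosK r X) _ _. Qed.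

Lemma r_invertible1 I : r (mul_invset I) 1 -> r_invertible r I.
Proof.
move=> r1; apply/seteqP; split => // x _.
by rewrite -(mul1g x); exact: rclos_absorb.
Qed.

(** As 1 lies in (II^{-1})_r, x lies in the r-closure of x II^{-1}. *)
Lemma r_invertible_detect I Z x : r_invertible r I ->
  (forall s, mul_invset I s -> r Z (x * s)) -> r Z x.
Proof.
move=> iI IZ; rewrite -(mulg1 x).
have : r (mul_invset I) 1 by rewrite iI.
by move=> /(rclos_mull x); apply: rclos_sub => _ [s Is <-]; exact: IZ.
Qed.

Lemma r_invertible_cancel I K J : r_invertible r I ->
  mulset I K `<=` r (mulset I J) -> K `<=` r J.
Proof.
move=> iI IKJ k Kk; apply: (r_invertible_detect iI) => s.
move=> /mul_invsetP[i [y [Ii /invsetP Iy sE]]].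
have [||h rh hE] := @rclos_frac y (mulset I J) (r J) _ (i * k).
- move=> _ [i' Ii' [j Jj <-]]; have [h hE] := Iy i' Ii'.
  exists (j * h); first exact/rclos_absorb/rclos_id.
  by rewrite !to_quotmM hE mulgC mulgA.
- by apply: IKJ; exists i => //; exists k.
move: rh; rewrite rclosK; congr (r J _); apply: to_quotm_inj.
by rewrite hE !to_quotmM sE mulgA mulgC (mulgC y).
Qed.

(** With L = (IK)_r, the set I L^{-1} is contained in K^{-1}, so the elements of
    (IK) L^{-1} lie in K K^{-1}; and their r-closure is H. *)
Lemma r_invertible_factor I K : r_invertible r (r (mulset I K)) ->
  r_invertible r K.
Proof.
move=> iIK; apply: r_invertible1.
apply: (r_invertible_detect iIK) => s /mul_invsetP[x [y [rx /invsetP IKy sE]]].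
rewrite mul1g.
have [|h rh hE] := @rclos_frac y (mulset I K) (mul_invset K) _ x rx.
  move=> _ [i Ii [k Kk <-]].
  have [|h hE] := IKy (i * k).
    by apply: rclos_id; exists i => //; exists k.
  exists h => //; apply/mul_invsetP; exists k, (y * to_quotm i); split=> //.
    apply/invsetP => k' Kk'; have [|h' h'E] := IKy (i * k').
      by apply: rclos_id; exists i => //; exists k'.
    by exists h'; rewrite h'E to_quotmM mulgA.
  by rewrite hE to_quotmM mulgA mulgC.
move: rh; congr (r _ _); apply: to_quotm_inj.
by rewrite hE sE mulgC.
Qed.

(** The cofactor is the r-closure of J I^{-1}, which is contained in H because J
    is contained in I. *)
Lemma r_invertible_dvd I J : r_invertible r I -> r_ideal r J -> J `<=` I ->
  exists2 K, r_ideal r K & J = r (mulset I K).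
Proof.
move=> iI rJ JI.
pose K := [set h | exists j y, [/\ J j, invset (@to_quotm H @` I) y &
                                   to_quotm h = y * to_quotm j]].
exists (r K); first exact: rclosK.
rewrite rclos_mulsetr; apply/seteqP; split.
  move=> j Jj; apply: (r_invertible_detect iI).
  move=> s /mul_invsetP[i [y [Ii Iy sE]]]; apply: rclos_id.
  have [h hE] := (invsetP _ _).1 Iy j (JI j Jj).
  exists i => //; exists h; first by exists j, y.
  by apply: to_quotm_inj; rewrite !to_quotmM hE sE mulgA mulgC.
apply: rclos_sub_ideal => // _ [i Ii [h [j [y [Jj Iy hE]]] <-]].
have [h' h'E] := (invsetP _ _).1 Iy i Ii.
suff -> : i * h = j * h' by exact: r_ideal_mulr rJ _ _ Jj.
by apply: to_quotm_inj; rewrite !to_quotmM hE h'E mulgCA [RHS]mulgCA;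
  congr (_ * _); exact: mulgC.
Qed.

(** As r is finitary, finitely many elements of II^{-1} have 1 in their
    r-closure; their factors in I generate I. *)
Lemma r_invertible_fg I : r_invertible r I ->
  exists E, [/\ finite_set E, E `<=` I & I `<=` r E].
Proof.
move=> iI; have : r (mul_invset I) 1 by rewrite iI.
rewrite rclos_fin => -[F [FI finF] F1].
have [f fP] : exists f : H -> H, forall s, F s -> I (f s) /\
    exists2 y, invset (@to_quotm H @` I) y & to_quotm s = to_quotm (f s) * y.
  suff /choice[f fP] : forall s, exists e, F s -> I e /\
      exists2 y, invset (@to_quotm H @` I) y & to_quotm s = to_quotm e * y.
    by exists f.
  move=> s; have [Fs|nFs] := pselect (F s); last by exists 1.
  have /mul_invsetP[i [y [Ii Iy sE]]] := FI s Fs.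
  by exists i; split=> //; exists y.
exists (f @` F); split; first exact: finite_image.
  by move=> _ [s /fP[? _] <-].
move=> i Ii; have := rclos_mull i F1; rewrite mulg1; apply: rclos_sub.
move=> _ [s Fs <-]; have [Ifs [y /invsetP/(_ i Ii)[h hE] sE]] := fP s Fs.
suff -> : i * s = f s * h by apply/rclos_absorb/rclos_id; exists s.
by apply: to_quotm_inj; rewrite !to_quotmM sE hE mulgCA (mulgC y).
Qed.

(** An element x of the r-closure of the radical lies in E_r for a finite set E
    of the radical; then x^n lies in (E^n)_r, which is in I for large n. *)
Lemma radical_r_ideal I : r_ideal r I -> r_ideal r (radical I).
Proof.
move=> rI; apply/seteqP; split; last exact: rclos_id.
have rclos_pow X n x : r X x -> r (setpow X n) (x ^+ n).
  move=> rx; elim: n => [|n IHn]; first by rewrite expg0; exact: rclos_id.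
  rewrite expgS /= -rclos_mulsetl -rclos_mulsetr; apply: rclos_id.
  by exists x => //; exists (x ^+ n).
rewrite rclos_fin => x [E [EI finE] rx].
have [n n0 EnI] := finite_sub_radical (r_ideal_mulr rI) finE EI.
by exists n => //; apply: (rclos_sub_ideal rI EnI); exact: rclos_pow.
Qed.

Lemma pideal_invertible a : ~ zeros H a ->
  r_invertible_ideals r (mulset [set a] setT).
Proof.
move=> na.
have aE : mulset [set a] setT = [set a * x | x in setT].
  apply/seteqP; split=> [_ [_ -> [x _ <-]]|_ [x _ <-]]; first by exists x.
  by exists a => //; exists x.
split; first by rewrite aE /r_ideal -rclos_mul rclosT.
apply: r_invertible1; apply: rclos_id; apply/mul_invsetP.
have [u au] := to_quotm_inv na.
exists a, u; split; last by rewrite au.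
  by rewrite aE; exists 1; rewrite ?mulg1.
apply/invsetP; rewrite aE => _ [x _ <-]; exists x.
by rewrite to_quotmM mulgA (mulgC u) au mul1g.
Qed.

Lemma zeros_mul a b : zeros H a -> zeros H (a * b).
Proof. by move=> za; rewrite za. Qed.

Lemma pideal_nz a : ~ zeros H a ->
  mulset [set a] setT `|` zeros H = mulset [set a] setT.
Proof.
move=> na; apply/setUidPl; apply: zeros_r_ideal.
by have [] := pideal_invertible na.
Qed.

(** The nonzero elements are closed under multiplication. *)
Lemma zeros_radical : is_radical (zeros H).
Proof.
apply/seteqP; split; last exact: radical_id.
move=> x [n _]; elim: n => [|n IHn].
  by rewrite expg0 => z1; have /nzP/(_ z1) := one_nz H.
rewrite expgS => zx; apply: contrapT => /[dup] nx /nzP bx.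
have nxn : ~ zeros H (x ^+ n) by move=> /IHn.
by have /nzP/(_ zx) := mulg_nz bx (introT (nzP _) nxn).
Qed.

Lemma nontrivial_principalP P : nontrivial_principal_ideal P ->
  exists2 a, ~ zeros H a & P = mulset [set a] setT.
Proof.
move=> [[A A1 ->] [_ /nonsubset[_ [[[a Aa [x _ <-]]|//] nax]]]].
have na : ~ zeros H a by move=> /(@zeros_mul _ x).
exists a => //; rewrite -pideal_nz//; congr (mulset _ _ `|` _).
by apply/seteqP; split=> [b Ab|_ ->//]; exact: A1.
Qed.

Lemma principal_idealP P : principal_ideal P ->
  P = zeros H \/ exists2 a, ~ zeros H a & P = mulset [set a] setT.
Proof.
move=> pP; have [zP|zP] := pselect (P `<=` zeros H).
  by left; apply/seteqP; split=> //; case: pP => A _ ->; right.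
right; apply: nontrivial_principalP; split=> //; split; last by [].
by case: pP => A _ ->; right.
Qed.

End Ideals.

(** * The monoid of r-invertible r-ideals *)

Section InvertibleIdealMonoid.
Variables (H : cancMonoidType) (r : finIdealSystem H).
Implicit Types (X : set H) (I J K : rinv_monoid r).

Lemma rinvP I : r_ideal r (val I) /\ r_invertible r (val I).
Proof. exact: set_mem (valP I). Qed.

Definition rinv_of X (iX : r_invertible_ideals r X) : rinv_monoid r :=
  SigSub (mem_set iX).

Lemma rinv_mdvdP I J : mdvd I J <-> val J `<=` val I.
Proof.
have [rI iI] := rinvP I; have [rJ iJ] := rinvP J; split.
  move=> [K ->]; apply: rclos_sub_ideal => // _ [x Ix [y _ <-]].
  exact: r_ideal_mulr rI _ _ Ix.
move=> /(r_invertible_dvd iI rJ)[K rK JE].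
have iK : r_invertible_ideals r K.
  by split=> //; apply: (@r_invertible_factor _ _ (val I)); rewrite -JE.
by exists (rinv_of iK); apply/val_inj.
Qed.

Lemma rinv_mulgI I J K : I * J = I * K -> J = K.
Proof.
have [_ iI] := rinvP I.
have incl (K1 K2 : rinv_monoid r) : I * K1 = I * K2 -> val K1 `<=` val K2.
  move=> /(congr1 val) /= IKE; have [rK2 _] := rinvP K2; rewrite -rK2.
  by apply: (r_invertible_cancel iI); rewrite -IKE; exact: rclos_id.
by move=> IE; apply/val_inj/seteqP; split; exact: incl.
Qed.

Lemma val_rinv_exp I n : val (I ^+ n) = r (setpow (val I) n).
Proof.
elim: n => [|n IHn].
  apply/seteqP; split => // x _; rewrite -(mul1g x).
  exact/rclos_absorb/rclos_id.
by rewrite expgS /= IHn rclos_mulsetr.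
Qed.

Lemma val_rinv_prod n (I : 'I_n -> rinv_monoid r) :
  val (\big[*%g/1]_(i < n) I i) = r_prod r (fun i => val (I i)).
Proof.
rewrite /r_prod; elim: n I => [|n IHn] I.
  rewrite !big_ord0; apply/seteqP; split => // x _; rewrite -(mul1g x).
  exact/rclos_absorb/rclos_id.
by rewrite !big_ord_recl /= IHn rclos_mulsetr.
Qed.

(** The nontrivial implication is where finite generation enters: J is generated
    by a finite subset of the radical of I, which has a power in I. *)
Lemma rinv_radicalP I J :
  (exists2 n, (0 < n)%N & mdvd I (J ^+ n)) <-> val J `<=` radical (val I).
Proof.
have [rI iI] := rinvP I; have [rJ iJ] := rinvP J; split.
  move=> [n n0 /rinv_mdvdP]; rewrite val_rinv_exp => JnI x Jx; exists n => //.
  exact/JnI/rclos_id/setpow_exp.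
move=> JI; have [E [finE EJ JE]] := r_invertible_fg iJ.
have [n n0 EnI] :=
  finite_sub_radical (r_ideal_mulr rI) finE (subset_trans EJ JI).
exists n => //; apply/rinv_mdvdP; rewrite val_rinv_exp.
suff : setpow (val J) n `<=` r (setpow E n).
  by move=> /rclos_sub/subset_trans; apply; exact: rclos_sub_ideal.
apply: subset_trans (_ : setpow (r E) n `<=` _).
  elim: (n) => [//|m IHm] _ [x Jx [y Jy <-]].
  by exists x; [exact: JE | exists y => //; exact: IHm].
elim: (n) => [|m IHm] /=; first exact: rclos_id.
move=> _ [x Ex [y Ey <-]]; rewrite -rclos_mulsetl -rclos_mulsetr.
by apply: rclos_id; exists x => //; exists y => //; exact: IHm.
Qed.

(** The monoid is cancellative, so a zero element forces it to be trivial. *)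
Lemma zeros_rinvP : zeros (rinv_monoid r) = set0 \/ forall I, I = 1.
Proof.
have [[Z zZ]|/forallNP nz] := pselect (exists Z, zeros (rinv_monoid r) Z).
  by right=> I; apply: (@rinv_mulgI Z); rewrite zZ mulg1.
by left; apply/seteqP; split=> // Z /nz.
Qed.

Lemma rinv_principalP (A : set (rinv_monoid r)) I :
  A I -> is_subset1 A -> forall J,
  (mulset A setT `|` zeros (rinv_monoid r)) J <-> val J `<=` val I.
Proof.
move=> AI A1 J; rewrite -rinv_mdvdP; split.
  move=> [[I' AI' [K _ <-]]|zJ].
    by rewrite (A1 _ _ AI' AI); exists K.
  have [z0|trivM] := zeros_rinvP; first by move: zJ; rewrite z0.
  by rewrite (trivM J) (trivM I); exact: mdvd_refl.
by move=> [K ->]; left; exists I => //; exists K.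
Qed.

(** Radicality in the monoid of ideals is tested on the principal ideal xH. *)
Lemma radical_elt_val I : radical_elt I -> is_radical (val I).
Proof.
move=> Irad; have [rI _] := rinvP I.
apply/seteqP; split; last exact: radical_id.
move=> x Ix; have [zx|nx] := pselect (zeros H x).
  exact: zeros_r_ideal rI _ zx.
have [n n0 In] : exists2 n, (0 < n)%N &
    mdvd I (rinv_of (pideal_invertible r nx) ^+ n).
  apply/rinv_radicalP => _ [_ -> [y _ <-]].
  exact: radical_semigroup_ideal (r_ideal_mulr rI) _ _ Ix.
have /rinv_mdvdP := Irad _ _ n0 In.
by apply; exists x => //; exists 1; rewrite ?mulg1.
Qed.

End InvertibleIdealMonoid.

(** * The equivalence *)

Section Equivalence.
Variables (H : cancMonoidType) (r : finIdealSystem H).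
Implicit Types P : set H.

Lemma comparable_min n (I : 'I_n.+1 -> set H) :
  (forall i j, I i `<=` I j \/ I j `<=` I i) ->
  exists j, forall i, I j `<=` I i.
Proof.
elim: n I => [|n IHn] I Icmp; first by exists ord0 => i; rewrite ord1.
have [j jP] := IHn (I \o lift ord0) (fun i j => Icmp _ _).
have [I0j|Ij0] := Icmp ord0 (lift ord0 j).
  exists ord0 => i; case: (unliftP ord0 i) => [k|] -> //.
  exact: subset_trans I0j (jP k).
by exists (lift ord0 j) => i; case: (unliftP ord0 i) => [k|] ->; [exact: jP|].
Qed.

(** An element of the smallest of the n factors lies in all of them, so its n-th
    power lies in the product; n is positive because the index j exists. *)
Lemma radical_rprod n (I : 'I_n -> set H) j :
  r_ideal r (I j) -> is_radical (I j) -> (forall i, I j `<=` I i) ->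
  radical (r_prod r I) = I j.
Proof.
move=> rIj radIj jmin; apply/seteqP; split.
  rewrite -[X in _ `<=` X]radIj; apply: radicalS; apply: rclos_sub_ideal => //.
  rewrite (bigD1 j)//= => _ [x Ix [y _ <-]].
  exact: r_ideal_mulr rIj _ _ Ix.
move=> x Ix; exists n; first by case: (n) j {rIj radIj jmin Ix} => // -[].
apply: rclos_id.
have : forall i, I i x by move=> i; exact: jmin.
elim: n I {j rIj radIj jmin Ix} => [|n IHn] I Ix.
  by rewrite big_ord0 expg0.
rewrite big_ord_recl expgS; exists x; first exact: Ix.
by exists (x ^+ n) => //; apply: IHn => i; exact: Ix.
Qed.

Lemma radical_comparable_rprod P : r_invertible_ideals r P ->
  rprod_comparable_radical r P -> r_invertible_ideals r (radical P).
Proof.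
move=> [rP iP] [[|n] [I [Irad Icmp PE]]].
  suff -> : radical P = setT by exact: r_invertible_ideals1.
  apply/seteqP; split => // x _; apply: radical_id.
  rewrite PE /r_prod big_ord0 -(mul1g x).
  exact/rclos_absorb/rclos_id.
have [j jmin] := comparable_min Icmp; have [rIj radIj] := Irad j.
rewrite PE (radical_rprod rIj radIj jmin); split=> //.
move: iP; rewrite PE /r_prod (bigD1 j)//= mulsetC.
exact: r_invertible_factor.
Qed.

(** Every s in II^{-1} is shown to lie in the r-closure of the product of the
    radical of I with its inverse. *)
Lemma radical_r_invertible :
  (forall a, ~ zeros H a ->
     r_invertible_ideals r (radical (mulset [set a] setT))) ->
  forall I, r_invertible_ideals r I -> r_invertible_ideals r (radical I).
Proof.
move=> Hrad I [rI iI]; have rradI := radical_r_ideal rI; split=> //.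
apply: r_invertible1; apply: (r_invertible_detect iI) => s.
rewrite mul1g => /mul_invsetP[e [y [Ie /invsetP Iy sE]]].
(* s I = e (y I) is contained in eH. *)
have seH x : I x -> mulset [set e] setT (s * x).
  move=> /Iy[h hE]; exists e => //; exists h => //.
  by apply: to_quotm_inj; rewrite !to_quotmM sE hE mulgA.
have [ze|ne] := pselect (zeros H e).
  suff zs : zeros H s by exact: zeros_r_ideal (rclosK r _) _ zs.
  move=> x; apply: to_quotm_inj.
  by rewrite to_quotmM sE mulgAC -to_quotmM ze.
have [_ iR] := Hrad e ne; set R := radical _ in iR.
have eI : mulset [set e] setT `<=` I.
  by move=> _ [_ -> [x _ <-]]; exact: r_ideal_mulr rI _ _ Ie.
have sR x : radical I x -> R (s * x).
  move=> [[//|n] _ /seH sxn]; exists n.+1 => //.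
  rewrite expgMn; last exact: mulgC.
  rewrite expgSr -mulgA mulgC.
  have [reH _] := pideal_invertible r ne.
  exact: r_ideal_mulr reH _ _ sxn.
apply: (r_invertible_detect iR) => t /mul_invsetP[f [u [Rf /invsetP Ru tE]]].
apply/rclos_id/mul_invsetP; exists f, (to_quotm s * u); split.
- exact: radicalS eI _ Rf.
(* s u lies in the inverse of the radical of I, because s maps the radical of
   I into R and u maps R into H. *)
- apply/invsetP => x /sR/Ru[h hE]; exists h.
  by rewrite hE to_quotmM mulgA (mulgC u).
- by rewrite to_quotmM tE mulgCA.
Qed.

Lemma rinv_principal_radical :
  (forall I, r_invertible_ideals r I -> r_invertible_ideals r (radical I)) ->
  forall P : set (rinv_monoid r), principal_ideal P ->
    principal_ideal (radical P).
Proof.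
move=> Hrad P [A A1 PE].
have [[I AI]|/forallNP A0] := pselect (exists I, A I); last first.
  exists set0 => //; rewrite PE.
  have -> : A = set0 by apply/seteqP; split=> // I /A0.
  have mul0 : mulset set0 setT = set0 :> set (rinv_monoid r).
    by apply/seteqP; split=> // K [K1 ].
  rewrite mul0 set0U; have [->|trivM] := zeros_rinvP r.
    by apply/seteqP; split=> // I [].
  apply/seteqP; split; last exact: radical_id.
  by move=> I _ J; rewrite (trivM I) (trivM J) mulg1.
pose S := rinv_of (Hrad _ (set_mem (valP I))).
exists [set S]; first by move=> _ _ -> ->.
apply/seteqP; split=> J.
  move=> [n n0]; rewrite PE => /(rinv_principalP AI A1) /rinv_mdvdP InJ.
  apply/(rinv_principalP (erefl S)) => [_ _ -> ->//|].
  by apply/rinv_radicalP; exists n.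
move=> /(rinv_principalP (erefl S)) /= SJ.
have [|n n0 /rinv_mdvdP InJ] := (rinv_radicalP I J).2.
  by apply: SJ => _ _ -> ->.
by exists n => //; rewrite PE; apply/(rinv_principalP AI A1).
Qed.

(** When the radical of a principal ideal is given with an empty set of
    generators, the monoid of r-invertible r-ideals has a zero and is trivial;
    otherwise its generator is the one that [radical_factorization] needs. *)
Lemma rprod_of_rinv_principal_radical :
  (forall P : set (rinv_monoid r), principal_ideal P ->
     principal_ideal (radical P)) ->
  forall I, r_invertible_ideals r I -> rprod_comparable_radical r I.
Proof.
move=> Hrad I iI.
have rad_ex (J : rinv_monoid r) : exists S, forall K,
    (exists2 n, (0 < n)%N & mdvd J (K ^+ n)) <-> mdvd S K.
  have J1 : is_subset1 [set J] by move=> _ _ -> ->.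
  pose P := mulset [set J] setT `|` zeros (rinv_monoid r).
  have PP K : P K <-> mdvd J K.
    by rewrite rinv_mdvdP; exact: (rinv_principalP (erefl J)).
  have [A A1 PE] : principal_ideal (radical P).
    by apply: Hrad; exists [set J].
  have radJ K : (exists2 n, (0 < n)%N & mdvd J (K ^+ n)) <-> radical P K.
    by split=> -[n n0 JK]; exists n => //; apply/PP.
  have [[S AS]|/forallNP A0] := pselect (exists S, A S).
    exists S => K; rewrite radJ PE rinv_mdvdP.
    exact: rinv_principalP.
  have : radical P J by apply/radical_id/PP/mdvd_refl.
  rewrite PE => -[[S /A0//]|zJ].
  have [z0|trivM] := zeros_rinvP r; first by move: zJ; rewrite z0.
  exists 1 => K; rewrite (trivM K) (trivM J); split=> _; first exact: mdvd_refl.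
  by exists 1%N => //; rewrite expg1; exact: mdvd_refl.
have [s [sE srad schain]] :=
  radical_factorization (@rinv_mulgI _ r) rad_ex (rinv_of iI).
exists (size s), (fun i => val (nth 1 s i)); split.
- move=> i; have [rIi _] := rinvP (nth 1 s i); split=> //.
  by apply/radical_elt_val/srad/mem_nth.
- move=> i j; rewrite -!rinv_mdvdP or_comm.
  by apply: schain; exact: mem_nth.
- rewrite -val_rinv_prod -(big_mkord xpredT (nth 1 s)).
  by rewrite -(big_nth _ xpredT id) -sE.
Qed.

(** The hypothesis on the closure of the empty set is what makes the trivial
    principal ideal, the set of zeros, an r-ideal. *)
Lemma principal_rprod :
  r set0 = zeros H ->
  (forall I, r_invertible_ideals r I -> rprod_comparable_radical r I) ->
  forall P, principal_ideal P -> rprod_comparable_radical r P.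
Proof.
move=> r0 Hinv P /(principal_idealP r)[->|[a na ->]]; last first.
  exact/Hinv/pideal_invertible.
have rz : r_ideal r (zeros H) by rewrite /r_ideal -{1}r0 rclosK.
exists 1%N, (fun=> zeros H); split=> [_|_ _|].
- by split=> //; exact: zeros_radical.
- by left.
- by rewrite /r_prod big_ord1 rz.
Qed.

End Equivalence.

Theorem proposition5p4 (H : cancMonoidType) (r : finIdealSystem H)
    (r0 : r set0 = zeros H) :
  [<-> forall P : set H, principal_ideal P -> rprod_comparable_radical r P;
       forall P : set H, nontrivial_principal_ideal P ->
         r_invertible_ideals r (radical P);
       forall I : set H, r_invertible_ideals r I ->
         r_invertible_ideals r (radical I);
       forall P : set (rinv_monoid r), principal_ideal P ->
         principal_ideal (radical P);
       forall I : set H, r_invertible_ideals r I ->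
         rprod_comparable_radical r I].
Proof.
tfae.
- move=> Hprod P ntP; have [a na PE] := nontrivial_principalP r ntP.
  apply: radical_comparable_rprod.
    by rewrite PE; exact: pideal_invertible.
  by apply: Hprod; case: ntP.
- move=> Hrad; apply: radical_r_invertible => a na; apply: Hrad; split.
    by exists [set a]; [move=> _ _ -> ->|rewrite (pideal_nz r)].
  have [ra _] := pideal_invertible r na; split; first exact: zeros_r_ideal ra.
  move=> /(_ a); apply: contra_not na; apply.
  by exists a => //; exists 1; rewrite ?mulg1.
- exact: rinv_principal_radical.
- exact: rprod_of_rinv_principal_radical.
- exact: principal_rprod.
Qed.
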